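(* Let $q\in\mathbb{R}^n$ and let $M\in\mathbb{R}^{n\times n}$ be a symmetric matrix. Assume that $M-\mathrm{Id}_n$ is nonsingular and $\|M-\mathrm{Id}_n\|<1$. Then the equation $$[M-\mathrm{Id}_n]P_{\mathcal K}(x)+x=-q,\qquad x\in\mathbb{R}^n,$$ has a unique solution $x^*\in\mathbb{R}^n$ and, for any starting point $x^0\in\mathbb{R}^n$, the sequence $\{x^k\}$ generated by $$\big[[M-\mathrm{Id}_n]V(x^k)+\mathrm{Id}_n\big]x^{k+1}=-q,\qquad V(x^k)\in\partial_BP_{\mathcal K}(x^k),\qquad k=0,1,\ldots,$$ is well-defined. Additionally, if $\|M-\mathrm{Id}_n\|<1/2$, then $\{x^k\}$ converges $Q$-linearly to $x^*$ as follows: $$\|x^*-x^{k+1}\|\le\frac{\|M-\mathrm{Id}_n\|}{1-\|M-\mathrm{Id}_n\|}\,\|x^*-x^k\|,\qquad k=0,1,\ldots.$$ Moreover, $P_{\mathcal K}(x^* )$ is a solution of the linear second order cone complementarity problem: find $z\in\mathbb{R}^n$ such that $z\in\mathcal K$, $Mz+q\in\mathcal K$ and $\langle Mz+q,z\rangle=0$.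
   Context: $\mathbb{R}^n$ carries the canonical inner product $\langle\cdot,\cdot\rangle$ and Euclidean norm $\|\cdot\|$; for a matrix $E\in\mathbb{R}^{n\times n}$, $\|E\|=\max\{\|Ex\|: \|x\|=1\}$; $\mathrm{Id}_n$ is the $n\times n$ identity matrix. $\mathcal K=\{x=(x_1,x_2)\in\mathbb{R}\times\mathbb{R}^{n-1}: \|x_2\|\le x_1\}$ is the second order cone and $P_{\mathcal K}$ is the Euclidean metric projection onto $\mathcal K$. For a locally Lipschitz map $F:\mathbb{R}^n\to\mathbb{R}^m$, with $D_F$ the set of points where $F$ is differentiable and $F'$ its Jacobian, the B-subdifferential is $\partial_BF(x)=\{V\in\mathbb{R}^{m\times n}: \exists\,\{x^k\}\subset D_F,\ x^k\to x,\ F'(x^k)\to V\}$. In the Newton iteration $V(x^k)$ is an arbitrary element of $\partial_BP_{\mathcal K}(x^k)$; ''well-defined'' means that the linear system at each step has a nonsingular matrix, so that $x^{k+1}$ exists and is unique, whatever the choice of $V(x^k)$. *)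

(* Defs.v *)
From mathcomp Require Import all_boot all_order all_algebra.
From mathcomp Require Import all_classical all_reals all_analysis.

Set Implicit Arguments.
Unset Strict Implicit.
Unset Printing Implicit Defensive.

Import Order.TTheory GRing.Theory Num.Theory.
Import numFieldNormedType.Exports.

Local Open Scope classical_set_scope.
Local Open Scope ring_scope.

(* Vectors are columns. The library norm `|x| on matrices is the entrywise sup
   norm, so the Euclidean norm is defined separately; the topology and the
   notion of differentiability are those of the sup norm, which coincide with
   the Euclidean ones in finite dimension. *)

Section Euclidean.
Context {R : realType}.

Definition inner n (x y : 'cV[R]_n) : R := \sum_(i < n) x i 0 * y i 0.

Definition enorm n (x : 'cV[R]_n) : R := Num.sqrt (inner x x).

(* The supremum is over the image of the Euclidean unit sphere; it is attained
   by compactness as soon as the domain has positive dimension. *)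
Definition opnorm m n (E : 'M[R]_(m, n)) : R :=
  sup [set enorm (E *m x) | x in [set x : 'cV[R]_n | enorm x = 1]].

Definition nearest n (C : set 'cV[R]_n) (x : 'cV[R]_n) : set 'cV[R]_n :=
  [set z | C z /\ forall y, C y -> enorm (x - z) <= enorm (x - y)].

(* `get` chooses an element of [nearest C x], which is a singleton when C is
   nonempty, closed and convex. *)
Definition metric_proj n (C : set 'cV[R]_n) (x : 'cV[R]_n) : 'cV[R]_n :=
  get (nearest C x).

End Euclidean.

Section BSubdifferential.
Context {R : realType}.

(* The library's `jacobian` is the transposed (row-vector) version. *)
Definition jacobian_mx m n (F : 'cV[R]_n.+1 -> 'cV[R]_m.+1) (x : 'cV[R]_n.+1) :
    'M[R]_(m.+1, n.+1) :=
  \matrix_(i, j) ('d F x : _ -> _) (delta_mx j 0) i 0.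

Definition Bsubdiff m n (F : 'cV[R]_n.+1 -> 'cV[R]_m.+1) (x : 'cV[R]_n.+1) :
    set 'M[R]_(m.+1, n.+1) :=
  [set V | exists u : nat -> 'cV[R]_n.+1,
    [/\ forall k, differentiable F (u k),
        u k @[k --> \oo] --> x
      & jacobian_mx F (u k) @[k --> \oo] --> V]].

End BSubdifferential.

Section SecondOrderCone.
Context {R : realType}.

(* The dimension is n.+1: x = (x 0 0, row' 0 x) in R x R^n. *)
Definition soc n : set 'cV[R]_n.+1 :=
  [set x | enorm (row' 0 x : 'cV[R]_n) <= x 0 0].

Definition proj_soc n : 'cV[R]_n.+1 -> 'cV[R]_n.+1 := metric_proj (@soc n).

Variables (n : nat) (M : 'M[R]_n.+1) (q : 'cV[R]_n.+1).
Implicit Types (x : 'cV[R]_n.+1) (V : 'M[R]_n.+1).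

Definition proj_equation x := (M - 1%:M) *m proj_soc x + x = - q.

Definition soclcp_solution z :=
  [/\ soc z, soc (M *m z + q) & inner (M *m z + q) z = 0].

Definition newton_mx V : 'M[R]_n.+1 := (M - 1%:M) *m V + 1%:M.

Definition newton_step x V x' :=
  Bsubdiff (@proj_soc n) x V /\ newton_mx V *m x' = - q.

Definition newton_sequence x0 (xs : nat -> 'cV[R]_n.+1)
    (Vs : nat -> 'M[R]_n.+1) :=
  xs 0%N = x0 /\ forall k, newton_step (xs k) (Vs k) (xs k.+1).

(* Only the values xs 0, ..., xs N and Vs 0, ..., Vs (N - 1) matter. *)
Definition newton_prefix x0 N (xs : nat -> 'cV[R]_n.+1)
    (Vs : nat -> 'M[R]_n.+1) :=
  xs 0%N = x0 /\
  forall k, (k < N)%N -> newton_step (xs k) (Vs k) (xs k.+1).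

(* Whatever the choices made in the first N steps, a choice of V(x^N) is
   available, and each such choice gives a nonsingular system, hence a unique
   next iterate. *)
Definition newton_well_defined x0 :=
  forall N xs Vs, newton_prefix x0 N xs Vs ->
    Bsubdiff (@proj_soc n) (xs N) !=set0 /\
    forall V, Bsubdiff (@proj_soc n) (xs N) V ->
      newton_mx V \in unitmx /\ exists! x', newton_mx V *m x' = - q.

(* Q-linear convergence of xs to x, with ratio c, in the Euclidean norm. *)
Definition Qlinear_cvg (c : R) (xs : nat -> 'cV[R]_n.+1) x :=
  [/\ c < 1, xs k @[k --> \oo] --> x
    & forall k, enorm (x - xs k.+1) <= c * enorm (x - xs k)].

End SecondOrderCone.

(* Main.v *)
Require Import Defs.
From mathcomp Require Import all_boot all_order all_algebra.
From mathcomp Require Import all_classical all_reals all_analysis.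
From mathcomp Require Import ring lra.
From HB Require Import structures.

(* Let P be the projection onto K and A = M - Id, a = ||A||. Banach's theorem
   applies to x |-> - q - A P(x), whose fixed points solve the equation. The
   reflection 2 P - Id is nonexpansive and P is positively homogeneous; passing
   to limits of Jacobians, every V in the B-subdifferential of P at x satisfies
   ||2 V h - h|| <= ||h|| and V x = P(x). The first property gives ||V|| <= 1,
   hence ||(A V + Id) h|| >= (1 - a) ||h|| and nonsingularity. Together they give
   ||P(y) - V y|| <= ||y - x||, because P(y) - V y is half the difference of
   (2 P - Id)(y) - (2 P - Id)(x) and (2 V - Id)(y - x). Convergence follows from
   (A V_k + Id)(y - x_(k+1)) = - A (P(y) - V_k y), y being the solution. *)

Set Implicit Arguments.
Unset Strict Implicit.
Unset Printing Implicit Defensive.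

Import Order.TTheory GRing.Theory Num.Theory.
Import numFieldNormedType.Exports.

Local Open Scope classical_set_scope.
Local Open Scope ring_scope.

(** * Euclidean inner product and norm *)

Section EuclideanNorm.
Context {R : realType}.
Variable n : nat.
Implicit Types (x y z : 'cV[R]_n) (a : R).

Lemma innerC x y : inner x y = inner y x.
Proof. by apply: eq_bigr => i _; rewrite mulrC. Qed.

Lemma innerDl x y z : inner (x + y) z = inner x z + inner y z.
Proof. by rewrite -big_split; apply: eq_bigr => i _; rewrite mxE mulrDl. Qed.

Lemma innerZl a x z : inner (a *: x) z = a * inner x z.
Proof. by rewrite mulr_sumr; apply: eq_bigr => i _; rewrite mxE mulrA. Qed.

Lemma innerNl x z : inner (- x) z = - inner x z.
Proof. by rewrite -scaleN1r innerZl mulN1r. Qed.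

Lemma innerDr x y z : inner z (x + y) = inner z x + inner z y.
Proof. by rewrite innerC innerDl !(innerC z). Qed.

Lemma innerZr a x z : inner z (a *: x) = a * inner z x.
Proof. by rewrite innerC innerZl innerC. Qed.

Lemma innerNr x z : inner z (- x) = - inner z x.
Proof. by rewrite innerC innerNl innerC. Qed.

Definition innerE := (innerDl, innerDr, innerNl, innerNr, innerZl, innerZr).

Lemma inner_ge0 x : 0 <= inner x x.
Proof. by apply: sumr_ge0 => i _; rewrite -expr2 sqr_ge0. Qed.

Lemma coord_sqr_le_inner x i : x i 0 ^+ 2 <= inner x x.
Proof.
rewrite /inner (bigD1 i) //= expr2 lerDl.
by apply: sumr_ge0 => j _; rewrite -expr2 sqr_ge0.
Qed.

Lemma enorm_ge0 x : 0 <= enorm x.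
Proof. exact: sqrtr_ge0. Qed.

Lemma sqr_enorm x : enorm x ^+ 2 = inner x x.
Proof. by rewrite sqr_sqrtr ?inner_ge0. Qed.

Lemma enorm_leP x a : 0 <= a -> (enorm x <= a) = (inner x x <= a ^+ 2).
Proof. by move=> a0; rewrite -sqr_enorm ler_sqr ?nnegrE ?enorm_ge0. Qed.

Lemma enorm_ler x y : (enorm x <= enorm y) = (inner x x <= inner y y).
Proof. by rewrite /enorm ler_sqrt ?inner_ge0. Qed.

Lemma coord_le_enorm x i : `|x i 0| <= enorm x.
Proof. by rewrite -sqrtr_sqr ler_sqrt ?inner_ge0 // coord_sqr_le_inner. Qed.

Lemma enorm0 : enorm (0 : 'cV[R]_n) = 0.
Proof. by rewrite /enorm /inner big1 ?sqrtr0 // => i _; rewrite mxE mul0r. Qed.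

Lemma enorm_eq0 x : (enorm x == 0) = (x == 0).
Proof.
apply/eqP/eqP => [x0|->]; last exact: enorm0.
apply/colP => i; rewrite mxE; apply/eqP.
by rewrite -normr_le0 -x0 coord_le_enorm.
Qed.

Lemma enormN x : enorm (- x) = enorm x.
Proof. by rewrite /enorm !innerE opprK. Qed.

Lemma enormZ a x : enorm (a *: x) = `|a| * enorm x.
Proof. by rewrite /enorm !innerE mulrA -expr2 sqrtrM ?sqr_ge0 // sqrtr_sqr. Qed.

(** Cauchy-Schwarz, from the nonnegative square of [enorm y *: x - enorm x *: y], whose expansion
    contains the desired difference as a factor. *)
Lemma inner_le_enorm x y : inner x y <= enorm x * enorm y.
Proof.
have [->|x0] := eqVneq x 0.
  by rewrite enorm0 mul0r /inner big1 // => i _; rewrite mxE mul0r.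
have [->|y0] := eqVneq y 0.
  by rewrite enorm0 mulr0 /inner big1 // => i _; rewrite mxE mulr0.
have : 0 <= inner (enorm y *: x - enorm x *: y) (enorm y *: x - enorm x *: y).
  exact: inner_ge0.
rewrite !innerE (innerC y x) -!sqr_enorm.
have : 0 < enorm x * enorm y.
  by rewrite mulr_gt0 // lt_neqAle enorm_ge0 eq_sym enorm_eq0 ?x0 ?y0.
move: (enorm x) (enorm y) (inner x y) => p q r pq.
rewrite (_ : _ + _ = 2 * (p * q) * (p * q - r)); last by ring.
by rewrite pmulr_rge0 ?subr_ge0 // mulr_gt0.
Qed.

Lemma ler_enormD x y : enorm (x + y) <= enorm x + enorm y.
Proof.
rewrite enorm_leP ?addr_ge0 ?enorm_ge0 // !innerE (innerC y x) sqrrD !sqr_enorm.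
by have := inner_le_enorm x y; lra.
Qed.

Lemma enormB x y : enorm (x - y) = enorm (y - x).
Proof. by rewrite -enormN opprB. Qed.

End EuclideanNorm.

(** * Operator norm of a matrix *)

Section OperatorNorm.
Context {R : realType}.
Variables m n : nat.
Implicit Type E : 'M[R]_(m, n).

(** The bound is the Frobenius norm, by Cauchy-Schwarz on each row. It makes the supremum in
    [opnorm] a true upper bound rather than the default value of [sup]. *)
Lemma enorm_mulmx_sphere_bounded E :
  exists C : R, forall x : 'cV[R]_n, enorm x = 1 -> enorm (E *m x) <= C.
Proof.
exists (Num.sqrt (\sum_i inner ((row i E)^T) ((row i E)^T))) => x x1.
rewrite /enorm ler_sqrt; last by apply: sumr_ge0 => i _; exact: inner_ge0.
apply: ler_sum => i _; rewrite -expr2.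
have -> : (E *m x) i 0 = inner ((row i E)^T) x.
  by rewrite mxE; apply: eq_bigr => j _; rewrite !mxE.
rewrite -sqr_enorm -[leRHS]mulr1 -(expr1n _ 2) -[X in _ * X ^+ 2]x1 -exprMn.
rewrite -ler_sqrt ?sqr_ge0 // !sqrtr_sqr [leRHS]ger0_norm ?mulr_ge0 ?enorm_ge0 //.
rewrite ler_norml inner_le_enorm andbT.
by rewrite lerNl -innerNl (le_trans (inner_le_enorm _ _)) // enormN.
Qed.

Lemma enorm_mulmx E (x : 'cV[R]_n) : enorm (E *m x) <= opnorm E * enorm x.
Proof.
have [->|x0] := eqVneq x 0; first by rewrite mulmx0 !enorm0 mulr0.
have nx0 : 0 < enorm x by rewrite lt_neqAle enorm_ge0 eq_sym enorm_eq0 x0.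
rewrite -ler_pdivrMr // mulrC.
have <- : enorm (E *m ((enorm x)^-1 *: x)) = (enorm x)^-1 * enorm (E *m x).
  by rewrite -scalemxAr enormZ ger0_norm // invr_ge0 ltW.
have [C EC] := enorm_mulmx_sphere_bounded E.
apply: ub_le_sup; first by exists C => _ [y y1 <-]; exact: EC.
exists ((enorm x)^-1 *: x) => //=.
by rewrite enormZ ger0_norm ?invr_ge0 ?ltW // mulVf // gt_eqF.
Qed.

End OperatorNorm.

Lemma opnorm_ge0 (R : realType) m n (E : 'M[R]_(m, n.+1)) : 0 <= opnorm E.
Proof.
have := enorm_mulmx E (delta_mx 0 0).
have -> : enorm (delta_mx 0 0 : 'cV[R]_n.+1) = 1.
  rewrite /enorm /inner (bigD1 0) //= big1 => [|i i0].
    by rewrite !mxE !eqxx mulr1 addr0 sqrtr1.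
  by rewrite !mxE (negPf i0) mul0r.
by rewrite mulr1; apply: le_trans; exact: enorm_ge0.
Qed.

(** * Projection onto the second order cone *)

Section SocProjection.
Context {R : realType}.
Variable n : nat.
Implicit Types (x y z w : 'cV[R]_n.+1) (a t : R).

Lemma inner_row' x y :
  inner x y = x 0 0 * y 0 0 + inner (row' 0 x : 'cV_n) (row' 0 y).
Proof.
rewrite /inner big_ord_recl; congr (_ + _).
by apply: eq_bigr => i _; rewrite !mxE.
Qed.

(** Half of self-duality: the product of the heads dominates the product of the tail norms, hence
    minus the inner product of the tails. *)
Lemma soc_inner_ge0 x y : soc x -> soc y -> 0 <= inner x y.
Proof.
rewrite /soc /= => xK yK; rewrite inner_row' -lerBlDr sub0r -innerNl.
apply: le_trans (inner_le_enorm _ _) _; rewrite enormN.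
by rewrite ler_pM ?enorm_ge0.
Qed.

Lemma row'_delta0 : row' 0 (delta_mx 0 0 : 'cV[R]_n.+1) = 0.
Proof. by apply/matrixP => i j; rewrite !mxE. Qed.

Lemma row'D x y : row' 0 (x + y) = row' 0 x + row' 0 y.
Proof. by apply/matrixP => i j; rewrite !mxE. Qed.

Lemma row'N x : row' 0 (- x) = - row' 0 x.
Proof. by apply/matrixP => i j; rewrite !mxE. Qed.

Lemma row'Z a x : row' 0 (a *: x) = a *: row' 0 x.
Proof. by apply/matrixP => i j; rewrite !mxE. Qed.

Lemma socZ a x : 0 <= a -> soc x -> soc (a *: x).
Proof.
move=> a0; rewrite /soc /= row'Z enormZ ger0_norm // mxE => xK.
by rewrite ler_wpM2l.
Qed.

(* The optimality conditions of the projection of x onto the self-dual cone. *)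
Definition soc_kkt x z := [/\ soc z, soc (z - x) & inner (z - x) z = 0].

Lemma soc_kkt_proj x z : soc_kkt x z -> proj_soc x = z.
Proof.
move=> [zK zxK zx0].
(* The cross term of the expansion around [z] is [inner (z - x) y], up to a positive factor, because
   [z - x] is orthogonal to [z]; it is nonnegative by self-duality. *)
have key y : soc y -> inner (x - z) (x - z) + inner (z - y) (z - y) <=
    inner (x - y) (x - y).
  move=> /(soc_inner_ge0 zxK) zxy.
  have -> : x - y = (x - z) + (z - y) by rewrite addrA subrK.
  by move: zx0 zxy; rewrite !innerE !(innerC z x) !(innerC y x) !(innerC y z); lra.
have zP : nearest (@soc R n) x z.
  split=> // y /key; rewrite enorm_ler; apply: le_trans.
  by rewrite lerDl inner_ge0.
have [] : nearest (@soc R n) x (proj_soc x) by apply: getPex; exists z.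
(* The point chosen by [get] is no farther from [x] than [z]; with [key] this forces its distance to
   [z] to vanish. *)
move: (proj_soc x) => y /key yK /(_ z zK); rewrite enorm_ler => yz.
have : enorm (z - y) <= 0.
  rewrite enorm_leP // expr0n /=. lra.
by rewrite le_eqVlt ltNge enorm_ge0 orbF enorm_eq0 subr_eq0 => /eqP.
Qed.

Lemma soc_kkt_id x : soc x -> soc_kkt x x.
Proof.
move=> xK; split=> //; rewrite subrr -(scale0r x); first exact: socZ.
by rewrite innerZl mul0r.
Qed.

Lemma soc_kkt_polar x : soc (- x) -> soc_kkt x 0.
Proof.
move=> xK; split; rewrite ?sub0r //.
  by rewrite -(scale0r (- x)); exact: socZ.
by rewrite -(scale0r x) innerZr mul0r.
Qed.

(* For |x_1| < ||x_2|| the projection is (x_1 + ||x_2||)/2 (1, x_2/||x_2||),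
   written here as a combination of e_0 and x. *)
Definition outer_proj x : 'cV[R]_n.+1 :=
  let s := enorm (row' 0 x : 'cV_n) in let b := (x 0 0 + s) / (2 * s) in
  ((x 0 0 + s) / 2 - b * x 0 0) *: delta_mx 0 0 + b *: x.

(** With [s] the tail norm, [z] and [z - x] have tails [b] and [b - 1] times that of [x], where
    [0 <= b <= 1] and [b * s] is the head of [z]. Both thus lie on the boundary of the cone with
    opposite tail directions, so the contributions of heads and tails to their inner product
    cancel. *)
Lemma soc_kkt_outer x : `|x 0 0| < enorm (row' 0 x : 'cV_n) ->
  soc_kkt x (outer_proj x).
Proof.
rewrite ltr_norml /outer_proj.
set s := enorm _ => /andP[xs1 xs2]; set b := _ / (2 * s).
have s0 : 0 < s by lra.
have b0 : 0 <= b by apply: divr_ge0; lra.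
have b1 : b <= 1 by rewrite /b ler_pdivrMr; lra.
have bs : b * s = (x 0 0 + s) / 2 by rewrite /b; field; lra.
set z := _ + _.
have z0 : z 0 0 = (x 0 0 + s) / 2 by rewrite !mxE !eqxx mulr1 subrK.
have rz : row' 0 z = b *: row' 0 x.
  by rewrite /z row'D !row'Z row'_delta0 scaler0 add0r.
have rzx : row' 0 (z - x) = (b - 1) *: row' 0 x.
  by rewrite row'D row'N rz scalerBl scale1r.
have zx0 : (z - x) 0 0 = (s - x 0 0) / 2.
  by rewrite mxE [(- x) 0 0]mxE z0; lra.
split.
- by rewrite /soc /= rz enormZ ger0_norm // z0 -/s bs.
- rewrite /soc /= rzx enormZ zx0 ler0_norm ?subr_le0 // -/s.
  by rewrite mulNr mulrBl bs mul1r; lra.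
rewrite inner_row' zx0 z0 rzx rz innerZl innerZr -sqr_enorm -/s.
by rewrite -[X in _ + X]/((b - 1) * (b * s ^+ 2)) /b; field; lra.
Qed.

Lemma soc_kkt_exists x : exists z, soc_kkt x z.
Proof.
have [xK|xK] := leP (enorm (row' 0 x : 'cV_n)) (x 0 0).
  by exists x; exact: soc_kkt_id.
have [xN|xN] := leP (enorm (row' 0 x : 'cV_n)) (- x 0 0).
  by exists 0; apply: soc_kkt_polar; rewrite /soc /= row'N enormN mxE.
by exists (outer_proj x); apply: soc_kkt_outer; rewrite ltr_norml xK ltrNl xN.
Qed.

Lemma proj_soc_kkt x : soc_kkt x (proj_soc x).
Proof. by have [z xz] := soc_kkt_exists x; rewrite (soc_kkt_proj xz). Qed.

(** The optimality conditions are invariant under nonnegative scaling. *)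
Lemma proj_socZ t x : 0 <= t -> proj_soc (t *: x) = t *: proj_soc x.
Proof.
move=> t0; have [zK zxK zx0] := proj_soc_kkt x; apply: soc_kkt_proj.
split; rewrite -?scalerBr; [exact: socZ|exact: socZ|].
by rewrite innerZl innerZr zx0 !mulr0.
Qed.

(** With [z] and [w] the projections, the difference of the squared sides is four times
    [inner (z - w) ((z - x) - (w - y))]. Complementarity leaves only minus [inner z (w - y)] and
    minus [inner w (z - x)], both nonpositive by self-duality. *)
Lemma reflect_soc_nonexpansive x y :
  enorm (2 *: (proj_soc x - proj_soc y) - (x - y)) <= enorm (x - y).
Proof.
have [xK xzK x0] := proj_soc_kkt x; have [yK yzK y0] := proj_soc_kkt y.
move: (proj_soc x) (proj_soc y) => z w in xK xzK x0 yK yzK y0 *.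
have := soc_inner_ge0 xzK yK; have := soc_inner_ge0 yzK xK.
rewrite enorm_ler; move: x0 y0.
rewrite !innerE !(innerC y x) !(innerC z x) !(innerC w x) !(innerC z y).
rewrite !(innerC w y) !(innerC w z); lra.
Qed.

Lemma proj_soc_nonexpansive x y :
  enorm (proj_soc x - proj_soc y) <= enorm (x - y).
Proof.
set p := _ - _; set d := x - y.
have -> : p = 2^-1 *: ((2 *: p - d) + d) by rewrite subrK scalerA mulVf ?scale1r.
rewrite enormZ ger0_norm // mulrC ler_pdivrMr // mulr_natr mulr2n.
apply: le_trans (ler_enormD _ _) _.
by rewrite lerD2r reflect_soc_nonexpansive.
Qed.

End SocProjection.

(** * Limits of matrices, products and Euclidean norms *)

Section MatrixLimits.
Context {R : realType} {T : Type} {F : set_system T} {FF : ProperFilter F}.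

Lemma cvg_mx_coord m n (f : T -> 'M[R]_(m, n)) (l : 'M[R]_(m, n)) :
  (forall i j, f x i j @[x --> F] --> l i j) -> f @ F --> l.
Proof.
move=> fl; apply/cvgrPdist_le => e e0; near=> x.
rewrite /Num.Def.normr/= mx_normrE (bigmax_le _ (ltW e0))//= => i _.
(* There are finitely many entries, so the conditions on each of them hold simultaneously near the
   limit. *)
rewrite !mxE; move: i; near: x; apply: (filter_forall (F := F)) => i /=.
by move/cvgrPdist_le : (fl i.1 i.2); exact.
Unshelve. all: by end_near. Qed.

Lemma cvg_coord m n (f : T -> 'M[R]_(m, n)) (l : 'M[R]_(m, n)) i j :
  f @ F --> l -> f x i j @[x --> F] --> l i j.
Proof.
move=> fl; apply: (cvg_comp f (fun N : 'M[R]_(m, n) => N i j) fl).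
exact: coord_continuous.
Qed.

Lemma cvg_mulmx m n p (f : T -> 'M[R]_(m, n)) (g : T -> 'M[R]_(n, p))
    (A : 'M[R]_(m, n)) (B : 'M[R]_(n, p)) :
  f @ F --> A -> g @ F --> B -> f x *m g x @[x --> F] --> A *m B.
Proof.
move=> fA gB; apply: cvg_mx_coord => i j; rewrite mxE.
under eq_cvg do rewrite mxE.
apply: cvg_big => [|k _]; first exact: add_continuous.
by apply: cvgM; exact: cvg_coord.
Qed.

Lemma cvg_inner n (f g : T -> 'cV[R]_n) (a b : 'cV[R]_n) :
  f @ F --> a -> g @ F --> b -> inner (f x) (g x) @[x --> F] --> inner a b.
Proof.
move=> fa gb; apply: cvg_big => [|k _]; first exact: add_continuous.
by apply: cvgM; exact: cvg_coord.
Qed.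

Lemma cvg_enorm n (f : T -> 'cV[R]_n) (a : 'cV[R]_n) :
  f @ F --> a -> enorm (f x) @[x --> F] --> enorm a.
Proof.
move=> fa; apply: (cvg_comp _ Num.sqrt (cvg_inner fa fa)).
exact: sqrt_continuous.
Qed.

(** Transfers Euclidean estimates to the sup norm, which carries the topology. *)
Lemma norm_le_enorm n (x : 'cV[R]_n) : `|x| <= enorm x.
Proof.
rewrite /Num.Def.normr/= mx_normrE (bigmax_le _ (enorm_ge0 x))//= => i _.
by rewrite [i.2]ord1; exact: coord_le_enorm.
Qed.

Lemma cvg_enorm_dist n (f : T -> 'cV[R]_n) (a : 'cV[R]_n) :
  enorm (a - f x) @[x --> F] --> 0 -> f @ F --> a.
Proof.
move=> fa; apply/cvgrPdist_le => e e0.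
move/cvgrPdist_le : fa => /(_ e e0); apply: filterS => x.
rewrite sub0r normrN ger0_norm ?enorm_ge0 //.
exact/le_trans/norm_le_enorm.
Qed.

End MatrixLimits.

(** * Differentials and Jacobian matrices *)

Section Differentials.
Context {R : realType}.

(** The first-order expansion of [g] at [x] is also one of [f], and a continuous linear map with
    this property is the differential. Used to replace the projection by its local formula. *)
Lemma near_eq_differentiable (V W : normedModType R) (f g : V -> W) x :
  (\forall y \near x, f y = g y) -> differentiable g x ->
  differentiable f x /\ 'd f x = 'd g x :> (V -> W).
Proof.
move=> fg dg.
have fx : f x = g x by exact: nbhs_singleton fg.
have H : f \o shift x = cst (f x) + 'd g x +o_ 0 id.
  apply/eqaddoP => e e0; have /eqaddoP/(_ e e0) := diff_locally dg.
  have fg0 : \forall h \near (0 : V), f (h + x) = g (h + x).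
    by move: fg; rewrite (near_shift 0) subr0.
  apply: filterS2 fg0 => h /= fgh.
  by rewrite !fctE /= fgh fx.
have E : 'd f x = 'd g x :> (V -> W).
  by apply: diff_unique => //; exact: diff_continuous.
split=> //; apply/diff_locallyP; split; last by rewrite E.
by rewrite E; exact: diff_continuous.
Qed.

Lemma jacobian_mxE m n (F : 'cV[R]_n.+1 -> 'cV[R]_m.+1) x h :
  jacobian_mx F x *m h = 'd F x h.
Proof.
apply/colP => i; rewrite mxE.
rewrite [in RHS](matrix_sum_delta h) linear_sum summxE.
by apply: eq_bigr => j _; rewrite big_ord1 linearZ !mxE mulrC.
Qed.

(** Difference quotients let inequalities and identities about [F] pass to its Jacobian. *)
Lemma cvg_jacobian_mx m n (F : 'cV[R]_n.+1 -> 'cV[R]_m.+1) x h :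
  differentiable F x ->
  t^-1 *: (F (t *: h + x) - F x) @[t --> 0^'] --> jacobian_mx F x *m h.
Proof.
move=> dF; rewrite jacobian_mxE -deriveE //.
exact: (diff_derivable (v := h) dF).
Qed.

Lemma differentiable_col m n (F : 'cV[R]_n -> 'cV[R]_m) x :
  (forall i, differentiable (fun y => F y i 0) x) -> differentiable F x.
Proof.
move=> dF.
have -> : F = \sum_(i < m) (fun y => F y i 0 *: delta_mx i 0).
  rewrite funeqE => y; rewrite fct_sumE [LHS]matrix_sum_delta.
  by apply: eq_bigr => i _; rewrite big_ord1.
by apply: differentiable_sum => i; exact: differentiableZl.
Qed.

(** Positivity keeps the argument of the square root away from zero, where it is not
    differentiable. *)
Lemma differentiable_enorm m n (F : 'cV[R]_n -> 'cV[R]_m) x :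
  (forall i, differentiable (fun y => F y i 0) x) -> 0 < enorm (F x) ->
  differentiable (fun y => enorm (F y)) x.
Proof.
move=> dF Fx; apply: (@differentiable_comp _ _ _ _ (fun y => inner (F y) (F y))).
  have -> : (fun y => inner (F y) (F y)) =
      \sum_(i < m) (fun y => F y i 0 * F y i 0).
    by rewrite funeqE => y; rewrite fct_sumE.
  by apply: differentiable_sum => i; exact: differentiableM.
apply/derivable1_diffP; apply: ex_derive; apply: is_derive1_sqrt.
by rewrite -sqr_enorm exprn_gt0.
Qed.

End Differentials.

(** * B-subdifferential of the projection *)

Section SocBsubdiff.
Context {R : realType}.
Variable n : nat.
Notation P := (@proj_soc R n).
Notation e0 := (delta_mx 0 0 : 'cV[R]_n.+1).
Notation tail x := (row' 0 x : 'cV[R]_n).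
Implicit Types (x y h : 'cV[R]_n.+1) (V : 'M[R]_n.+1).

Lemma cvg_proj_soc (T : Type) (F : set_system T) (FF : ProperFilter F)
    (f : T -> 'cV[R]_n.+1) x :
  f @ F --> x -> P (f t) @[t --> F] --> P x.
Proof.
move=> fx; apply: cvg_enorm_dist.
have xf0 : enorm (x - f t) @[t --> F] --> 0.
  rewrite -(@enorm0 R n.+1) -(subrr x); apply: cvg_enorm.
  by apply: cvgB => //; exact: cvg_cst.
apply: (squeeze_cvgr _ (cvg_cst 0) xf0).
by apply: nearW => t; rewrite enorm_ge0 proj_soc_nonexpansive.
Qed.

(** Nonexpansiveness of the reflection between [t *: h + x] and [x], divided by the absolute value
    of [t], passes to the limit. *)
Lemma jacobian_soc_reflect x h : differentiable P x ->
  enorm (2 *: (jacobian_mx P x *m h) - h) <= enorm h.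
Proof.
move=> dP; have Jh := cvg_jacobian_mx (h := h) dP.
have H : 2 *: (t^-1 *: (P (t *: h + x) - P x)) - h @[t --> 0^'] -->
    2 *: (jacobian_mx P x *m h) - h.
  by apply: cvgB; [apply: cvgZ => //|]; exact: cvg_cst.
apply: (ler_cvg_to (cvg_enorm H) (cvg_cst (enorm h))).
near=> t.
have t0 : t != 0 by near: t; exact: nbhs_dnbhs_neq.
set p := P _ - _.
have -> : 2 *: (t^-1 *: p) - h = t^-1 *: (2 *: p - (t *: h + x - x)).
  by rewrite addrK [RHS]scalerBr !scalerA (mulrC t^-1) mulVf // scale1r.
rewrite enormZ normfV mulrC ler_pdivrMr ?normr_gt0 //.
rewrite (le_trans (reflect_soc_nonexpansive _ _)) //.
by rewrite addrK enormZ mulrC.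
Unshelve. all: by end_near. Qed.

(** Euler's identity: in the direction [x] itself, homogeneity makes the difference quotient
    constantly [P x] for small [t]. *)
Lemma jacobian_soc_Euler x : differentiable P x -> jacobian_mx P x *m x = P x.
Proof.
move=> dP; have Jh := cvg_jacobian_mx (h := x) dP.
apply: (cvg_unique _ Jh); first exact: norm_hausdorff.
apply: cvg_near_cst; near=> t.
have t0 : t != 0 by near: t; exact: nbhs_dnbhs_neq.
(* [t] may be negative, while homogeneity holds for nonnegative factors only. *)
have t1 : 0 <= t + 1.
  rewrite -lerBlDr sub0r; have : `|t| < 1 by near: t; exact: dnbhs0_lt.
  by rewrite ltr_norml => /andP[/ltW].
have -> : t *: x + x = (t + 1) *: x by rewrite scalerDl scale1r.
rewrite proj_socZ // scalerDl scale1r.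
by rewrite addrK scalerA mulVf // scale1r.
Unshelve. all: by end_near. Qed.

Lemma Bsubdiff_soc_reflect x V h : Bsubdiff P x V ->
  enorm (2 *: (V *m h) - h) <= enorm h.
Proof.
move=> [u [du ux JV]].
have H : 2 *: (jacobian_mx P (u k) *m h) - h @[k --> \oo] --> 2 *: (V *m h) - h.
  apply: cvgB; last exact: cvg_cst.
  by apply: cvgZ; [|apply: cvg_mulmx => //]; exact: cvg_cst.
apply: (ler_cvg_to (cvg_enorm H) (cvg_cst (enorm h))).
by apply: nearW => k; exact: jacobian_soc_reflect.
Qed.

Lemma Bsubdiff_soc_contract x V h : Bsubdiff P x V -> enorm (V *m h) <= enorm h.
Proof.
move=> /(Bsubdiff_soc_reflect h) Vh.
have -> : V *m h = 2^-1 *: ((2 *: (V *m h) - h) + h).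
  by rewrite subrK scalerA mulVf ?scale1r.
rewrite enormZ ger0_norm // mulrC ler_pdivrMr // mulr_natr mulr2n.
by apply: le_trans (ler_enormD _ _) _; rewrite lerD2r.
Qed.

(** Euler's identity along the sequence defining [V]; continuity of [P] identifies the limit. *)
Lemma Bsubdiff_soc_Euler x V : Bsubdiff P x V -> V *m x = P x.
Proof.
move=> [u [du ux JV]].
have H : P (u k) @[k --> \oo] --> V *m x.
  under eq_cvg do rewrite -jacobian_soc_Euler //.
  exact: cvg_mulmx.
apply: (cvg_unique _ H); first exact: norm_hausdorff.
exact: cvg_proj_soc.
Qed.

(** The estimate holds for all [x] and [y], near or far, which is why the Newton iteration converges
    from any starting point. *)
Lemma Bsubdiff_soc_approx x y V : Bsubdiff P x V ->
  enorm (P y - V *m y) <= enorm (y - x).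
Proof.
move=> xV.
have -> : P y - V *m y = 2^-1 *: ((2 *: (P y - P x) - (y - x)) -
    (2 *: (V *m (y - x)) - (y - x))).
  have -> : P y - V *m y = (P y - P x) - V *m (y - x).
    by rewrite mulmxBr (Bsubdiff_soc_Euler xV) opprB addrA subrK.
  move: (y - x) (P y - P x) => d p.
  by rewrite opprB addrA subrK -scalerBr scalerA mulVf // scale1r.
rewrite enormZ ger0_norm // mulrC ler_pdivrMr // mulr_natr mulr2n.
apply: le_trans (ler_enormD _ _) _; rewrite enormN; apply: lerD.
  exact: reflect_soc_nonexpansive.
exact: Bsubdiff_soc_reflect xV.
Qed.

Lemma enorm_tail_continuous : continuous (fun y => enorm (tail y)).
Proof.
move=> x; suff tx : tail y @[y --> x] --> tail x by exact: (cvg_enorm tx).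
apply: (@cvg_mx_coord R _ (nbhs x) _ _ _ (fun y => tail y)) => i j; rewrite mxE.
under eq_cvg do rewrite mxE.
exact: (@coord_continuous R n.+1 1 _ _ x).
Qed.

(** For [c] equal to 1 and -1, this makes the strict inequalities that separate the three regimes of
    the projection stable near [x]. *)
Lemma coord_gap_continuous c :
  continuous (fun y : 'cV[R]_n.+1 => y 0 0 + c * enorm (tail y)).
Proof.
move=> x.
have sx : c * enorm (tail y) @[y --> x] --> c * enorm (tail x).
  exact: (cvgM (cvg_cst c) (@enorm_tail_continuous x)).
have x0 := @coord_continuous R n.+1 1 0 0 x.
exact: (cvgD x0 sx).
Qed.

Lemma jacobian_soc_int x : enorm (tail x) < x 0 0 ->
  differentiable P x /\ jacobian_mx P x = 1%:M.
Proof.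
move=> xK.
have Pid : \forall y \near x, P y = id y.
  have xK' : 0 < x 0 0 + -1 * enorm (tail x) by lra.
  near=> y; apply: soc_kkt_proj; apply: soc_kkt_id; rewrite /soc /=.
  suff : 0 < y 0 0 + -1 * enorm (tail y) by lra.
  by near: y; exact: (cvgr_gt _ (@coord_gap_continuous (-1) x)).
have [dP dE] := near_eq_differentiable Pid (@ex_diff _ _ _ _ _ _ _ (is_diff_id x)).
split; first exact: dP.
by apply/matrixP => i j; rewrite mxE dE diff_val [LHS]mxE [RHS]mxE andbT.
Unshelve. all: by end_near. Qed.

Lemma jacobian_soc_polar_int x : enorm (tail x) < - x 0 0 ->
  differentiable P x /\ jacobian_mx P x = 0.
Proof.
move=> xK.
have P0 : \forall y \near x, P y = cst 0 y.
  have xK' : x 0 0 + 1 * enorm (tail x) < 0 by lra.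
  near=> y; apply: soc_kkt_proj; apply: soc_kkt_polar.
  rewrite /soc /= row'N enormN mxE.
  suff : y 0 0 + 1 * enorm (tail y) < 0 by lra.
  by near: y; exact: (cvgr_lt _ (@coord_gap_continuous 1 x)).
have [dP dE] := near_eq_differentiable P0 (differentiable_cst _ _).
split; first exact: dP.
by apply/matrixP => i j; rewrite mxE dE diff_cst !mxE.
Unshelve. all: by end_near. Qed.

(** A nonzero tail makes both the tail norm and the division by it differentiable. *)
Lemma differentiable_outer_proj x : 0 < enorm (tail x) ->
  differentiable (@outer_proj R n) x.
Proof.
move=> s0.
have dc i : differentiable (fun y : 'cV[R]_n.+1 => y i 0) x.
  exact: differentiable_coord.
have ds : differentiable (fun y => enorm (tail y)) x.
  apply: differentiable_enorm => // i.
  by under eq_fun do rewrite mxE.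
apply: differentiable_col => i.
have db : differentiable
    (fun y : 'cV[R]_n.+1 => (y 0 0 + enorm (tail y)) / (2 * enorm (tail y))) x.
  apply: differentiableM; first exact: differentiableD.
  apply: differentiableV; last by rewrite mulf_neq0 ?gt_eqF.
  exact: differentiableM.
under eq_fun do rewrite !mxE.
apply: differentiableD; last exact: differentiableM.
apply: differentiableM => //; apply: differentiableB.
  by apply: differentiableM => //; exact: differentiableD.
exact: differentiableM.
Qed.

Lemma differentiable_soc_outer x : `|x 0 0| < enorm (tail x) ->
  differentiable P x.
Proof.
move=> xo; have Po : \forall y \near x, P y = outer_proj y.
  move: xo; rewrite ltr_norml => /andP[x1 x2].
  have x1' : 0 < x 0 0 + 1 * enorm (tail x) by lra.
  have x2' : x 0 0 + -1 * enorm (tail x) < 0 by lra.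
  near=> y; apply: soc_kkt_proj; apply: soc_kkt_outer.
  rewrite ltr_norml; apply/andP; split.
    suff : 0 < y 0 0 + 1 * enorm (tail y) by lra.
    by near: y; exact: (cvgr_gt _ (@coord_gap_continuous 1 x)).
  suff : y 0 0 + -1 * enorm (tail y) < 0 by lra.
  by near: y; exact: (cvgr_lt _ (@coord_gap_continuous (-1) x)).
have s0 : 0 < enorm (tail x) by apply: le_lt_trans xo.
by have [] := near_eq_differentiable Po (differentiable_outer_proj s0).
Unshelve. all: by end_near. Qed.

(* At x in K (resp. -K) the Jacobian is constant along the points x + t e_0
   (resp. x - t e_0), t > 0; elsewhere P is differentiable at x itself. *)
Lemma Bsubdiff_soc_neq0 x : Bsubdiff P x !=set0.
Proof.
have ux (c : R) : x + (c * harmonic k) *: e0 @[k --> \oo] --> x.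
  rewrite -[X in _ --> X]addr0 -(scale0r e0).
  apply: cvgD; first exact: cvg_cst.
  apply: cvgZ; last exact: cvg_cst.
  rewrite -(mulr0 c).
  by apply: cvgM; [exact: cvg_cst|exact: cvg_harmonic].
have tu a : tail (x + a *: e0) = tail x.
  by rewrite row'D row'Z row'_delta0 scaler0 addr0.
have u0 a : (x + a *: e0) 0 0 = x 0 0 + a by rewrite !mxE eqxx mulr1.
have [xK|xK] := leP (enorm (tail x)) (x 0 0).
  exists 1%:M, (fun k => x + (1 * harmonic k) *: e0).
  have J k : enorm (tail (x + (1 * harmonic k) *: e0)) <
             (x + (1 * harmonic k) *: e0) 0 0.
    by rewrite tu u0 mul1r (le_lt_trans xK) // ltrDl harmonic_gt0.
  split=> // [k|]; first by have [] := jacobian_soc_int (J k).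
  under eq_cvg do rewrite (jacobian_soc_int (J _)).2.
  exact: cvg_cst.
have [xN|xN] := leP (enorm (tail x)) (- x 0 0).
  exists 0, (fun k => x + (-1 * harmonic k) *: e0).
  have J k : enorm (tail (x + (-1 * harmonic k) *: e0)) <
             - (x + (-1 * harmonic k) *: e0) 0 0.
    by rewrite tu u0 mulN1r (le_lt_trans xN) // opprB ltrDr harmonic_gt0.
  split=> // [k|]; first by have [] := jacobian_soc_polar_int (J k).
  under eq_cvg do rewrite (jacobian_soc_polar_int (J _)).2.
  exact: cvg_cst.
exists (jacobian_mx P x), (fun=> x); split; [move=> _|exact: cvg_cst..].
by apply: differentiable_soc_outer; rewrite ltr_norml xK ltrNl xN.
Qed.

End SocBsubdiff.

(** Combines completeness of matrices with their normed structure, for use of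
    [banach_fixed_point]. *)
HB.instance Definition _ (R : realType) m n :=
  Complete.on 'M[R]_(m.+1, n.+1).

(** * Fixed points of Euclidean contractions *)

Section EuclideanBanach.
Context {R : realType}.

Lemma enorm_le_norm n (x : 'cV[R]_n) : enorm x <= Num.sqrt n%:R * `|x|.
Proof.
rewrite enorm_leP ?mulr_ge0 ?sqrtr_ge0 // exprMn sqr_sqrtr //.
rewrite mulr_natl -[X in _ *+ X]card_ord -sumr_const; apply: ler_sum => i _.
rewrite -expr2 -real_normK ?num_real // ler_sqr ?nnegrE //.
rewrite [leRHS]/Num.Def.normr/= mx_normrE.
exact: (le_bigmax _ (fun j : 'I_n * 'I_1 => `|x j.1 j.2|) (i, 0)).
Qed.

(* A Euclidean contraction need not contract the sup norm, but a high enough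
   iterate does, and the fixed point of the iterate is fixed by f. *)
Lemma enorm_contraction_fixpoint n (f : 'cV[R]_n.+1 -> 'cV[R]_n.+1) (a : R) :
  0 <= a < 1 -> (forall x y, enorm (f x - f y) <= a * enorm (x - y)) ->
  exists p, f p = p.
Proof.
move=> /andP[a0 a1] fa.
have iterE N x y : enorm (iter N f x - iter N f y) <= a ^+ N * enorm (x - y).
  elim: N => [|N IH]; first by rewrite expr0 mul1r.
  by rewrite !iterS exprS -mulrA (le_trans (fa _ _)) // ler_wpM2l.
(* The factor [Num.sqrt n.+1%:R] is the cost of bounding the Euclidean norm by the sup norm. *)
have [N aN] : exists N, a ^+ N * Num.sqrt n.+1%:R < 1.
  have /cvgrPdist_lt/(_ _ ltr01) [N _ /(_ N (leqnn N))] :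
      geometric (Num.sqrt n.+1%:R) a @ \oo --> (0 : R).
    by apply: cvg_geometric; rewrite ger0_norm.
  rewrite /= sub0r normrN mulrC ger0_norm ?mulr_ge0 ?exprn_ge0 ?sqrtr_ge0 //.
  by exists N.
have q0 : 0 <= a ^+ N * Num.sqrt n.+1%:R by rewrite mulr_ge0 ?exprn_ge0 ?sqrtr_ge0.
pose g : {fun [set: 'cV[R]_n.+1] >-> [set: 'cV[R]_n.+1]} := 'totalfun_setT (iter N f).
have gctr : is_contraction g.
  exists (NngNum q0); split=> //= -[x y] _ /=.
  rewrite (le_trans (norm_le_enorm _)) // (le_trans (iterE _ _ _)) // -mulrA.
  by rewrite ler_wpM2l ?exprn_ge0 // enorm_le_norm.
have [p _ pN] : exists2 p, setT p & p = g p.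
  by apply: banach_fixed_point => //; exists 0.
(* [f p] is fixed by the iterate too, since [f] commutes with its iterates; uniqueness gives
   [f p = p]. *)
exists p; apply: esym; apply: (contraction_fixpoint_unique gctr) => //.
have fpN : f p = iter N f (f p) by rewrite -iterSr iterS; congr f.
exact: fpN.
Qed.

End EuclideanBanach.

(** * The projection equation and its Newton iteration *)

Section SocNewton.
Context {R : realType}.
Variables (n : nat) (M : 'M[R]_n.+1) (q : 'cV[R]_n.+1).
Hypothesis normM : opnorm (M - 1%:M) < 1.
Notation A := (M - 1%:M).
Notation P := (@proj_soc R n).
Notation a := (opnorm A).
Implicit Types (x y : 'cV[R]_n.+1) (V : 'M[R]_n.+1).

Lemma proj_equation_unique_solution :
  exists x, unique (proj_equation M q) x.
Proof.
have eqE x : proj_equation M q x <-> - q - A *m P x = x.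
  rewrite /proj_equation; split=> [<-|xE]; first by rewrite addrC addKr.
  by rewrite -{2}xE addrC subrK.
have contr x y : enorm ((- q - A *m P x) - (- q - A *m P y)) <= a * enorm (x - y).
  have -> : (- q - A *m P x) - (- q - A *m P y) = A *m (P y - P x).
    by rewrite mulmxBr opprD !opprK addrACA addNr add0r addrC.
  rewrite (le_trans (enorm_mulmx _ _)) // enormB ler_wpM2l ?opnorm_ge0 //.
  exact: proj_soc_nonexpansive.
have [|x fx] := enorm_contraction_fixpoint (a := a) _ contr.
  by rewrite opnorm_ge0.
exists x; split=> [|y /eqE fy]; first exact/eqE.
have := contr x y; rewrite fx fy => xy.
apply/eqP; rewrite -subr_eq0 -enorm_eq0 eq_le enorm_ge0 andbT.
have a1 : 0 < 1 - a by rewrite subr_gt0.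
by rewrite -(pmulr_rle0 _ a1) mulrBl mul1r subr_le0.
Qed.

(** The equation says [M *m P x + q = P x - x], which turns the complementarity conditions into the
    optimality conditions of the projection. *)
Lemma proj_equation_soclcp x : proj_equation M q x -> soclcp_solution M q (P x).
Proof.
move=> xE; have [PK PxK Px0] := proj_soc_kkt x.
suff ME : M *m P x + q = P x - x by split; rewrite ?ME.
rewrite -[q]opprK -xE mulmxBl mul1mx.
by rewrite opprD opprB addrA [X in X - _]addrC subrK.
Qed.

Lemma newton_mx_lower_bound x V h : Bsubdiff P x V ->
  (1 - a) * enorm h <= enorm (newton_mx M V *m h).
Proof.
move=> xV; have hE : h = newton_mx M V *m h - A *m (V *m h).
  by rewrite /newton_mx mulmxDl mul1mx -mulmxA addrC addKr.
have : enorm h <= enorm (newton_mx M V *m h) + a * enorm h.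
  rewrite {1}hE (le_trans (ler_enormD _ _)) // lerD2l enormN.
  rewrite (le_trans (enorm_mulmx _ _)) // ler_wpM2l ?opnorm_ge0 //.
  exact: Bsubdiff_soc_contract xV.
by lra.
Qed.

Lemma newton_mx_unit x V : Bsubdiff P x V -> newton_mx M V \in unitmx.
Proof.
(* [kermx] is a left kernel; transposing turns its rows into column vectors killed by
   [newton_mx M V], to which the lower bound applies. *)
move=> xV; rewrite -unitmx_tr -row_free_unit -kermx_eq0; apply/eqP/row_matrixP => i.
set w := row i _; have wN : w *m (newton_mx M V)^T = 0.
  by rewrite -row_mul mulmx_ker row0.
apply/eqP; rewrite row0 -trmx_eq0 -enorm_eq0 eq_le enorm_ge0 andbT.
have := newton_mx_lower_bound w^T xV.
rewrite -[newton_mx M V *m _]trmxK trmx_mul trmxK wN trmx0 enorm0.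
by rewrite pmulr_rle0 // subr_gt0.
Qed.

Lemma newton_well_definedP x0 : newton_well_defined M q x0.
Proof.
move=> N xs Vs _; split; first exact: Bsubdiff_soc_neq0.
move=> V /newton_mx_unit Vu; split=> //.
exists (invmx (newton_mx M V) *m - q); split; first by rewrite mulKVmx.
by move=> y <-; rewrite mulKmx.
Qed.

Lemma newton_step_contract xs x V x' : proj_equation M q xs ->
  newton_step M q x V x' -> enorm (xs - x') <= a / (1 - a) * enorm (xs - x).
Proof.
move=> xsE [xV x'E].
(* Substituting [A *m P xs + xs] for [- q] cancels the two terms [xs]. *)
have NE : newton_mx M V *m (xs - x') = - (A *m (P xs - V *m xs)).
  rewrite mulmxBr x'E -xsE /newton_mx mulmxDl mul1mx -mulmxA mulmxBr.
  by rewrite opprB opprD addrACA subrr addr0.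
rewrite mulrAC ler_pdivlMr ?subr_gt0 // mulrC.
rewrite (le_trans (newton_mx_lower_bound _ xV)) // NE enormN.
rewrite (le_trans (enorm_mulmx _ _)) // ler_wpM2l ?opnorm_ge0 //.
exact: Bsubdiff_soc_approx.
Qed.

Lemma newton_Qlinear_cvg xstar x0 xs Vs : a < 1 / 2 ->
  proj_equation M q xstar -> newton_sequence M q x0 xs Vs ->
  Qlinear_cvg (a / (1 - a)) xs xstar.
Proof.
move=> a2 xE [_ steps]; set c := a / (1 - a).
have a0 : 0 <= a by exact: opnorm_ge0.
have c0 : 0 <= c by rewrite divr_ge0 // subr_ge0 ltW.
(* [a < 1 / 2] is equivalent to [a < 1 - a], that is, to a ratio below 1. *)
have c1 : c < 1 by rewrite ltr_pdivrMr ?subr_gt0 //; lra.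
have step k : enorm (xstar - xs k.+1) <= c * enorm (xstar - xs k).
  exact: newton_step_contract xE (steps k).
have geo k : enorm (xstar - xs k) <= geometric (enorm (xstar - xs 0%N)) c k.
  elim: k => [|k IH] /=; first by rewrite expr0 mulr1.
  by rewrite (le_trans (step k)) // exprS mulrCA ler_wpM2l.
split=> //; apply: cvg_enorm_dist.
have g0 : geometric (enorm (xstar - xs 0%N)) c @ \oo --> (0 : R).
  by apply: cvg_geometric; rewrite ger0_norm.
apply: (squeeze_cvgr _ (cvg_cst 0) g0).
by apply: nearW => k; rewrite enorm_ge0 geo.
Qed.

End SocNewton.

Theorem theorem4 (R : realType) (n : nat) (q : 'cV[R]_n.+1) (M : 'M[R]_n.+1)
    (symM : M^T = M)
    (nonsingM : M - 1%:M \in unitmx)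
    (normM : opnorm (M - 1%:M) < 1) :
  exists xstar : 'cV[R]_n.+1,
    [/\ unique (proj_equation M q) xstar,
        forall x0 : 'cV[R]_n.+1, newton_well_defined M q x0,
        opnorm (M - 1%:M) < 1 / 2 ->
          forall (x0 : 'cV[R]_n.+1) (xs : nat -> 'cV[R]_n.+1)
                 (Vs : nat -> 'M[R]_n.+1),
            newton_sequence M q x0 xs Vs ->
            Qlinear_cvg (opnorm (M - 1%:M) / (1 - opnorm (M - 1%:M))) xs xstar
      & soclcp_solution M q (proj_soc xstar)].
Proof.
have [xstar [xE xuniq]] := proj_equation_unique_solution q normM.
exists xstar; split=> [|x0|a2 x0 xs Vs|]; first by split.
- exact: newton_well_definedP.
- exact: newton_Qlinear_cvg.
- exact: proj_equation_soclcp.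
Qed.
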